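(* Let $G$ be a finite group and $h\in G$. Let $\varphi:G\to G$ be the inner automorphism given by $\varphi(g)=hgh^{-1}$ and consider the generalized Alexander quandle $A_\varphi(G)$. Let $$N=\big\langle\,[h,g]\ \big|\ g\in G\,\big\rangle$$ be the subgroup of $G$ generated by the commutators $[h,g]=hgh^{-1}g^{-1}$. Then the forward orbits in $A_\varphi(G)$ satisfy $$\mathcal O^{+}(x)=xN \qquad \text{for all } x\in G.$$
   Context: A quandle is a set $Q$ with a binary operation $\rhd$ such that for all $x,y,z\in Q$: (1) $x\rhd x=x$; (2) for each $y$ the map $R_y(x)=x\rhd y$ (the right translation by $y$) is a bijection $Q\to Q$; (3) $(x\rhd y)\rhd z=(x\rhd z)\rhd(y\rhd z)$. For a group $G$ and $\varphi\in\mathrm{Aut}(G)$, the generalized Alexander quandle $A_\varphi(G)$ is the set $G$ with operation $x\rhd y=\varphi(xy^{-1})y$. For a quandle $Q$ and $x\in Q$, the forward orbit of $x$ is $\mathcal O^{+}(x)=\{R_{y_k}\cdots R_{y_1}(x) : k\ge 0,\ y_1,\ldots,y_k\in Q\}$ (with $k=0$ giving $x$ itself). *)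

(* Defs.v *)
From HB Require Import structures.
From mathcomp Require Import all_boot all_fingroup.

Set Implicit Arguments.
Unset Strict Implicit.
Unset Printing Implicit Defensive.

Local Open Scope group_scope.

Record quandle := Quandle {
  quandle_sort :> Type;
  qop : quandle_sort -> quandle_sort -> quandle_sort;
  qop_idem : forall x, qop x x = x;
  qop_bij : forall y, bijective (fun x => qop x y);
  qop_dist : forall x y z, qop (qop x y) z = qop (qop x z) (qop y z)
}.

(* [foldl] applies R_{y_1} first, so this is
   R_{y_k} ... R_{y_1} x for ys = [:: y_1; ...; y_k]. *)
Definition act_word (Q : quandle) (x : Q) (ys : seq Q) : Q :=
  foldl (@qop Q) x ys.

Definition forward_orbit (Q : quandle) (x z : Q) : Prop :=
  exists ys : seq Q, z = act_word x ys.

Record group_aut (G : groupType) := GroupAut {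
  gaut_fun :> G -> G;
  gautM : {morph gaut_fun : x y / x * y};
  gaut_bij : bijective gaut_fun
}.

Section Alexander.
Variables (G : groupType) (phi : group_aut G).

Definition alexander_op (x y : G) : G := phi (x * y^-1) * y.

Lemma gaut1 : phi 1 = 1.
Proof. by apply: (mulgI (phi 1)); rewrite -gautM !mulg1. Qed.

Lemma gautV x : phi x^-1 = (phi x)^-1.
Proof. by apply: (mulgI (phi x)); rewrite -gautM !mulgV gaut1. Qed.

Lemma alexander_idem x : alexander_op x x = x.
Proof. by rewrite /alexander_op mulgV gaut1 mul1g. Qed.

Lemma alexander_bij y : bijective (fun x => alexander_op x y).
Proof.
have [psi phiK psiK] := gaut_bij phi.
exists (fun x => psi (x * y^-1) * y) => x; rewrite /alexander_op.
  by rewrite mulgK phiK mulgKV.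
by rewrite mulgK psiK mulgKV.
Qed.

Lemma alexander_dist x y z :
  alexander_op (alexander_op x y) z
    = alexander_op (alexander_op x z) (alexander_op y z).
Proof.
by rewrite /alexander_op invgM !gautM !gautV !gautM !gautV !invgM !invgK
  !mulgA !(mulgKV, mulgK).
Qed.

Definition alexander_quandle : quandle :=
  Quandle alexander_idem alexander_bij alexander_dist.

End Alexander.

Section Inner.
Variables (G : groupType) (h : G).

(* The library's [g ^ h] is h^-1 * g * h, the opposite convention. *)
Definition inner_fun (g : G) : G := h * g * h^-1.

Lemma inner_funM : {morph inner_fun : x y / x * y}.
Proof. by move=> x y; rewrite /inner_fun !mulgA mulgKV. Qed.

Lemma inner_fun_bij : bijective inner_fun.
Proof.
exists (fun g => h^-1 * g * h) => g; rewrite /inner_fun !mulgA.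
  by rewrite mulVg mul1g mulgKV.
by rewrite mulgV mul1g mulgK.
Qed.

Definition inner_aut : group_aut G := GroupAut inner_funM inner_fun_bij.

End Inner.

(* The library's [~ x, y] is x^-1 * y^-1 * x * y; here [h, g] is
   h * g * h^-1 * g^-1. *)
Definition comm_lconv (G : groupType) (h g : G) : G := h * g * h^-1 * g^-1.

Definition comm_subgroup (gT : finGroupType) (h : gT) : {group gT} :=
  <<[set comm_lconv h g | g : gT]>>%G.

(* Main.v *)
(* The right translation by y is x |-> h x (y^-1 h y)^-1.  Each step multiplies
   x on the right by [h, x^-1]^-1 [h, y^-1], so orbits stay inside xN.
   Conversely, let m be the order of h: m - 1 translations by 1 followed by one
   by g^-1 send x to h^m x h^-(m-1) (g h g^-1)^-1 = x [h, g], and since G is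
   finite, every element of N is a product of such commutators. *)
Require Import Defs.
From mathcomp Require Import all_boot all_fingroup.

Local Open Scope group_scope.

Lemma forward_orbit_trans {Q : quandle} {x} y {z : Q} :
  forward_orbit x y -> forward_orbit y z -> forward_orbit x z.
Proof.
by move=> [s ->] [t ->]; exists (s ++ t); rewrite /act_word foldl_cat.
Qed.

Lemma alexander_innerE (G : groupType) (h x y : G) :
  alexander_op (inner_aut h) x y = h * x * (h^-1 ^ y).
Proof. by rewrite /alexander_op /= /inner_fun conjgE !mulgA. Qed.

Lemma alexander_inner_commE (G : groupType) (h x y : G) :
  alexander_op (inner_aut h) x y
    = x * ((comm_lconv h x^-1)^-1 * comm_lconv h y^-1).
Proof.
by rewrite alexander_innerE /comm_lconv conjgE !invgM !invgK !mulgA mulgV mul1g mulgKV.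
Qed.

Lemma act_word_nseq1 (G : groupType) (h x : G) n :
  act_word (Q := alexander_quandle (inner_aut h)) x (nseq n 1)
    = h ^+ n * x * h ^- n.
Proof.
elim: n x => [|n IHn] x; first by rewrite /act_word /= !expg0 invg1 mulg1 mul1g.
(* The first translation is applied innermost, so the induction hypothesis is used at h x h^-1
   instead of x. *)
by rewrite [LHS]IHn [qop _ _]alexander_innerE conjg1 expgSr invgM !mulgA.
Qed.

Lemma comm_lconv_in (G : finGroupType) (h g : G) :
  comm_lconv h g \in comm_subgroup h.
Proof. by apply: mem_gen; apply: imset_f. Qed.

Lemma forward_orbit_comm (G : finGroupType) (h x g : G) :
  forward_orbit (Q := alexander_quandle (inner_aut h)) x (x * comm_lconv h g).
Proof.
apply: (forward_orbit_trans (Q := alexander_quandle (inner_aut h))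
  (h ^+ #[h].-1 * x * h ^- #[h].-1)).
  by exists (nseq #[h].-1 1); rewrite act_word_nseq1.
exists [:: g^-1].
(* Since h^(m-1) = h^-1, the intermediate point is h^-1 x h. *)
rewrite [RHS]alexander_innerE -invg_expg !invgK conjgE invgK /comm_lconv.
by rewrite !mulgA mulgV mul1g.
Qed.

Theorem theorem4p8 (G : finGroupType) (h x z : G) :
  forward_orbit (Q := alexander_quandle (inner_aut h)) x z
    <-> z \in x *: comm_subgroup h.
Proof.
split=> [[ys ->] | /lcosetP [n /gen_prodgP [k [c cP ->]] ->]].
  elim: ys x => [|y ys IHys] x; first exact: lcoset_refl.
  (* One translation preserves the coset, so xN can be rebased at the new point. *)
  rewrite (_ : x *: _ = alexander_op (inner_aut h) x y *: comm_subgroup h).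
    exact: IHys.
  apply: lcoset_eqP; rewrite alexander_inner_commE mem_lcoset invgM mulgKV.
  by rewrite groupV groupM ?groupV ?comm_lconv_in.
elim: k c cP => [|k IHk] c cP; first by exists [::]; rewrite big_ord0 mulg1.
(* Splitting off the last commutator leaves x times a shorter product, reachable by induction. *)
rewrite big_ord_recr /= mulgA.
have /imsetP [g _ ->] := cP ord_max.
apply: forward_orbit_trans _ (forward_orbit_comm _ _ _ _).
exact: IHk.
Qed.
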